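(* Let $X$ be a topological space. Then we can define a functor $$T:\mathrm{PreSh}(X)\to\mathrm{PreMed}(X),\qquad \mathcal{F}\mapsto M_{\mathcal{F}},$$ by mapping each presheaf $\mathcal{F}$ over $X$ to $M_{\mathcal{F}}:=\bigsqcup_{U\in\mathrm{Open}(X)}\mathcal{F}(U)$, the pre-meadow with $\mathbf{a}$ endowed with the operations $$s+t:=\rho_{U\cap V,U}(s)+\rho_{U\cap V,V}(t),\qquad s\cdot t:=\rho_{U\cap V,U}(s)\cdot\rho_{U\cap V,V}(t)\qquad (s\in\mathcal{F}(U),\ t\in\mathcal{F}(V)),$$ and mapping each morphism of presheaves $\varphi:\mathcal{F}\to\mathcal{L}$ to the homomorphism of pre-meadows $$\varphi':M_{\mathcal{F}}\to M_{\mathcal{L}},\qquad x\mapsto\varphi(U)(x),$$ where $U$ is the unique open set such that $x\in\mathcal{F}(U)$.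
   Context: $\mathrm{Open}(X)$ is the lattice of open subsets of $X$ ordered by inclusion. $\mathrm{PreSh}(X)$ is the category of presheaves of rings on $X$. For a presheaf of rings $\mathcal{F}$ on $X$ and open sets $V\subseteq U$, $\rho_{V,U}:\mathcal{F}(U)\to\mathcal{F}(V)$ denotes the restriction map; it is required that $\mathcal{F}(\emptyset)=0$, the zero ring. A morphism of presheaves $\varphi:\mathcal{F}\to\mathcal{L}$ is a family of ring homomorphisms $\varphi(U):\mathcal{F}(U)\to\mathcal{L}(U)$ commuting with the restriction maps. All rings are commutative with unit and ring homomorphisms preserve units. In $M_{\mathcal{F}}$ the sums and products on the right-hand sides are computed in $\mathcal{F}(U\cap V)$, the element $0$ is the zero of $\mathcal{F}(X)$, $1$ is the unit of $\mathcal{F}(X)$, and $-$ is the negation in each ring $\mathcal{F}(U)$. A pre-meadow is a set $P$ with two distinct elements $0,1$, binary operations $+,\cdot$ and a unary operation $-$ satisfying: $(P_1)$ $(x+y)+z=x+(y+z)$; $(P_2)$ $x+y=y+x$; $(P_3)$ $x+0=x$; $(P_4)$ $x+(-x)=0\cdot x$; $(P_5)$ $(x\cdot y)\cdot z=x\cdot(y\cdot z)$; $(P_6)$ $x\cdot y=y\cdot x$; $(P_7)$ $1\cdot x=x$; $(P_8)$ $x\cdot(y+z)=x\cdot y+x\cdot z$; $(P_9)$ $-(-x)=x$; $(P_{10})$ $0\cdot(x+y)=0\cdot x\cdot y$. The set $0\cdot P=\{0\cdot x\mid x\in P\}$ is partially ordered by $z\le z'$ iff $z\cdot z'=z$. For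 $z\in 0\cdot P$ put $P_z=\{x\in P\mid 0\cdot x=z\}$. A pre-meadow with $\mathbf{a}$ is a pre-meadow $P$ for which there exists a unique element of $0\cdot P$, denoted $\mathbf{a}$, such that $|P_{\mathbf{a}}|=1$ and $x+\mathbf{a}=\mathbf{a}$ for all $x\in P$. A homomorphism of pre-meadows is a map preserving $+$, $\cdot$ and $1$. $\mathrm{PreMed}(X)$ is the category whose objects are the pre-meadows with $\mathbf{a}$, $P$, such that $0\cdot P$ is isomorphic as a lattice to $\mathrm{Open}(X)$, and whose morphisms are all homomorphisms of pre-meadows with $\mathbf{a}$ between them.
   Formalization: As 0 and 1 must be distinct in a pre-meadow, the claim fails for the zero presheaf; the functor to PreMed(X) is proved on presheaves with F(X) not the zero ring, and on all presheaves when PreMed(X) is relaxed to allow 0 = 1. *)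

(* Defs.v *)
From mathcomp Require Import all_boot all_algebra.
From mathcomp Require Import boolp classical_sets functions cardinality topology.

Set Implicit Arguments.
Unset Strict Implicit.
Unset Printing Implicit Defensive.

Import GRing.Theory.
Local Open Scope classical_set_scope.
Local Open Scope ring_scope.

(* [compose] is in diagrammatic order. *)
Record category := Category {
  obj :> Type;
  mor : obj -> obj -> Type;
  idmap : forall A, mor A A;
  compose : forall A B C, mor A B -> mor B C -> mor A C;
  compose1f : forall A B (f : mor A B), compose (idmap A) f = f;
  composef1 : forall A B (f : mor A B), compose f (idmap B) = f;
  composeA : forall A B C D (f : mor A B) (g : mor B C) (h : mor C D),
    compose f (compose g h) = compose (compose f g) h
}.

Definition is_functor (C D : category) (F0 : C -> D)
    (F1 : forall A B : C, mor A B -> mor (F0 A) (F0 B)) : Prop :=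
  (forall A, F1 A A (idmap A) = idmap (F0 A)) /\
  (forall (A B E : C) (f : mor A B) (g : mor B E),
     F1 A E (compose f g) = compose (F1 A B f) (F1 B E g)).

Definition full_subcategory (C : category) (Q : C -> Prop) : category :=
  @Category {A : C | Q A}
    (fun A B => mor (sval A) (sval B))
    (fun A => idmap (sval A))
    (fun A B E f g => compose f g)
    (fun A B f => compose1f f)
    (fun A B f => composef1 f)
    (fun A B E G f g h => composeA f g h).

Section Lattice.
Variables (A B : Type) (leA : A -> A -> Prop) (leB : B -> B -> Prop).

Definition is_meet (x y m : A) :=
  [/\ leA m x, leA m y & forall w, leA w x -> leA w y -> leA w m].

Definition is_join (x y j : A) :=
  [/\ leA x j, leA y j & forall w, leA x w -> leA y w -> leA j w].

Record is_lattice : Prop := IsLattice {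
  lattice_refl : forall x, leA x x;
  lattice_anti : forall x y, leA x y -> leA y x -> x = y;
  lattice_trans : forall x y z, leA x y -> leA y z -> leA x z;
  lattice_meet : forall x y, exists m, is_meet x y m;
  lattice_join : forall x y, exists j, is_join x y j
}.

End Lattice.

Definition isomorphic_lattices (A B : Type)
    (leA : A -> A -> Prop) (leB : B -> B -> Prop) : Prop :=
  is_lattice leA /\ is_lattice leB /\
  exists f : A -> B,
    [/\ bijective f,
        forall x y m, is_meet leA x y m -> is_meet leB (f x) (f y) (f m) &
        forall x y j, is_join leA x y j -> is_join leB (f x) (f y) (f j)].

Record pm_struct := PmStruct {
  pm_carrier :> Type;
  pm0 : pm_carrier;
  pm1 : pm_carrier;
  pm_add : pm_carrier -> pm_carrier -> pm_carrier;
  pm_mul : pm_carrier -> pm_carrier -> pm_carrier;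
  pm_opp : pm_carrier -> pm_carrier
}.

Arguments pm0 {p}.
Arguments pm1 {p}.

Declare Scope pm_scope.
Delimit Scope pm_scope with pm.
Notation "0" := pm0 : pm_scope.
Notation "1" := pm1 : pm_scope.
Notation "x + y" := (pm_add x y) : pm_scope.
Notation "x * y" := (pm_mul x y) : pm_scope.
Notation "- x" := (pm_opp x) : pm_scope.

Section PreMeadow.
Local Open Scope pm_scope.
Variable P : pm_struct.

Record pm_axioms : Prop := PmAxioms {
  pm_P1 : forall x y z : P, (x + y) + z = x + (y + z);
  pm_P2 : forall x y : P, x + y = y + x;
  pm_P3 : forall x : P, x + 0 = x;
  pm_P4 : forall x : P, x + (- x) = 0 * x;
  pm_P5 : forall x y z : P, (x * y) * z = x * (y * z);
  pm_P6 : forall x y : P, x * y = y * x;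
  pm_P7 : forall x : P, 1 * x = x;
  pm_P8 : forall x y z : P, x * (y + z) = x * y + x * z;
  pm_P9 : forall x : P, - (- x) = x;
  pm_P10 : forall x y : P, 0 * (x + y) = 0 * x * y
}.

Definition is_premeadow : Prop := (0 : P) <> 1 /\ pm_axioms.

Definition zero_set : set P := [set z | exists x : P, z = 0 * x].

Definition zero_le (z z' : {z : P | zero_set z}) : Prop :=
  sval z * sval z' = sval z.

Definition pm_fiber (z : P) : set P := [set x | 0 * x = z].

Definition has_a : Prop :=
  exists! a : P, [/\ zero_set a, (pm_fiber a #= `I_1)%card &
                     forall x : P, x + a = a].

End PreMeadow.

Definition is_pm_hom (P Q : pm_struct) (f : P -> Q) : Prop :=
  [/\ forall x y, f (x + y)%pm = (f x + f y)%pm,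
      forall x y, f (x * y)%pm = (f x * f y)%pm &
      f 1%pm = 1%pm].

Lemma is_pm_hom_id (P : pm_struct) : is_pm_hom (fun x : P => x).
Proof. by []. Qed.

Lemma is_pm_hom_comp (P Q S : pm_struct) (f : P -> Q) (g : Q -> S) :
  is_pm_hom f -> is_pm_hom g -> is_pm_hom (fun x => g (f x)).
Proof.
move=> [fD fM f1] [gD gM g1].
by split=> [x y|x y|]; rewrite ?fD ?fM ?f1 ?gD ?gM ?g1.
Qed.

Definition Open (X : topologicalType) := {U : set X | open U}.

Definition open_le (X : topologicalType) (V U : Open X) : Prop :=
  sval V `<=` sval U.

Definition openT_ (X : topologicalType) : Open X := exist _ setT openT.

Definition open0_ (X : topologicalType) : Open X := exist _ set0 open0.

Definition openI_ (X : topologicalType) (U V : Open X) : Open X :=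
  exist _ (sval U `&` sval V) (openI (svalP U) (svalP V)).

Lemma openI_l (X : topologicalType) (U V : Open X) : open_le (openI_ U V) U.
Proof. exact: subIsetl. Qed.

Lemma openI_r (X : topologicalType) (U V : Open X) : open_le (openI_ U V) V.
Proof. exact: subIsetr. Qed.

Arguments openI_l {X} U V.
Arguments openI_r {X} U V.

(* [Q] is the class of structures from which the objects are taken:
   [is_premeadow] for PreMed(X) itself, [pm_axioms] for the variant in which
   the constants 0 and 1 are allowed to coincide. *)
Definition in_PreMed (Q : pm_struct -> Prop) (X : topologicalType)
    (P : pm_struct) : Prop :=
  [/\ Q P, has_a P & isomorphic_lattices (@zero_le P) (@open_le X)].

Section PreMedOf.
Variables (Q : pm_struct -> Prop) (X : topologicalType).

Definition PreMed_obj := {P : pm_struct | in_PreMed Q X P}.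

Definition PreMed_hom (P S : PreMed_obj) :=
  {f : sval P -> sval S | is_pm_hom f}.

Definition PreMed_id (P : PreMed_obj) : PreMed_hom P P :=
  exist _ _ (is_pm_hom_id (sval P)).

Definition PreMed_comp (P S T : PreMed_obj)
    (f : PreMed_hom P S) (g : PreMed_hom S T) : PreMed_hom P T :=
  exist _ _ (is_pm_hom_comp (svalP f) (svalP g)).

Lemma PreMed_hom_ext (P S : PreMed_obj) (f g : PreMed_hom P S) :
  (forall x, sval f x = sval g x) -> f = g.
Proof.
case: f g => [f fh] [g gh] /= /funext fg.
by case: _ / fg in gh *; rewrite (Prop_irrelevance fh gh).
Qed.

Definition PreMedOf : category.
Proof.
refine (@Category PreMed_obj PreMed_hom PreMed_id PreMed_comp _ _ _);
  by move=> *; apply: PreMed_hom_ext.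
Defined.

End PreMedOf.

Definition PreMed (X : topologicalType) : category := PreMedOf is_premeadow X.

Definition PreMedWeak (X : topologicalType) : category := PreMedOf pm_axioms X.

(* The values are [comPzRingType]s, so that the zero ring is allowed. *)
Record presheaf (X : topologicalType) := Presheaf {
  sect :> Open X -> comPzRingType;
  res : forall V U : Open X, open_le V U -> {rmorphism sect U -> sect V};
  res_id : forall (U : Open X) (h : open_le U U) (s : sect U), res h s = s;
  res_comp : forall (W V U : Open X) (hWV : open_le W V) (hVU : open_le V U)
    (hWU : open_le W U) (s : sect U), res hWV (res hVU s) = res hWU s;
  sect_empty : forall s : sect (open0_ X), s = 0
}.

Record presheaf_hom (X : topologicalType) (F L : presheaf X) := PresheafHom {
  app :> forall U : Open X, {rmorphism F U -> L U};
  app_res : forall (V U : Open X) (h : open_le V U) (s : F U),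
    res L h (app U s) = app V (res F h s)
}.

Lemma rmorphism_ext (A B : comPzRingType) (f g : {rmorphism A -> B}) :
  f =1 g -> f = g.
Proof.
case: f g => [f cf] [g cg] /= /funext fg.
case: _ / fg in cg *; congr GRing.RMorphism.Pack.
case: cf cg => [[fD] [fM]] [[gD] [gM]].
by rewrite (Prop_irrelevance fD gD) (Prop_irrelevance fM gM).
Qed.

Section PreSh.
Variable X : topologicalType.

Lemma presheaf_hom_ext (F L : presheaf X) (f g : presheaf_hom F L) :
  (forall U, f U =1 g U) -> f = g.
Proof.
case: f g => [f fr] [g gr] /= fg.
have {}fg : f = g.
  by apply: functional_extensionality_dep => U; exact: rmorphism_ext (fg U).
by case: _ / fg in gr *; rewrite (Prop_irrelevance fr gr).
Qed.

Definition presheaf_id (F : presheaf X) : presheaf_hom F F :=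
  @PresheafHom X F F (fun U => idfun : {rmorphism F U -> F U})
    (fun V U h s => erefl).

Definition presheaf_comp (F G L : presheaf X)
  (f : presheaf_hom F G) (g : presheaf_hom G L) : presheaf_hom F L.
Proof.
refine (@PresheafHom X F L
  (fun U => (g U : G U -> L U) \o (f U : F U -> G U) : {rmorphism F U -> L U}) _).
by move=> V U h s /=; rewrite app_res app_res.
Defined.

Definition PreSh : category.
Proof.
refine (@Category (presheaf X) (@presheaf_hom X) presheaf_id presheaf_comp _ _ _);
  by move=> *; apply: presheaf_hom_ext.
Defined.

(* The non-zero presheaves: since restrictions preserve 1, [0 = 1] in F(X)
   forces every F(U) to be the zero ring. *)
Definition PreShNonzero : category :=
  @full_subcategory PreSh (fun F : presheaf X => (0 : F (openT_ X)) <> 1).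

End PreSh.

Section MF.
Variables (X : topologicalType) (F : presheaf X).

Definition M_carrier : Type := {U : Open X & F U}.

Definition M_zero : M_carrier := existT _ (openT_ X) (0 : F (openT_ X)).

Definition M_one : M_carrier := existT _ (openT_ X) (1 : F (openT_ X)).

Definition M_add (s t : M_carrier) : M_carrier :=
  existT _ (openI_ (projT1 s) (projT1 t))
    (res F (openI_l (projT1 s) (projT1 t)) (projT2 s) +
     res F (openI_r (projT1 s) (projT1 t)) (projT2 t)).

Definition M_mul (s t : M_carrier) : M_carrier :=
  existT _ (openI_ (projT1 s) (projT1 t))
    (res F (openI_l (projT1 s) (projT1 t)) (projT2 s) *
     res F (openI_r (projT1 s) (projT1 t)) (projT2 t)).

Definition M_opp (s : M_carrier) : M_carrier :=
  existT _ (projT1 s) (- projT2 s).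

Definition M : pm_struct := PmStruct M_zero M_one M_add M_mul M_opp.

Lemma M_zero_neq_one :
  (0%pm : M) <> 1%pm <-> (0 : F (openT_ X)) <> 1.
Proof.
split=> neq eq01; apply: neq; first by rewrite /= /M_zero /M_one eq01.
have gen (a b : M_carrier) : a = b ->
    forall (ha : open_le (openT_ X) (projT1 a)) hb,
    res F ha (projT2 a) = res F hb (projT2 b).
  by move=> -> ha hb; rewrite (Prop_irrelevance ha hb).
have hT : open_le (openT_ X) (openT_ X) by [].
by have := gen _ _ eq01 hT hT; rewrite /= !res_id.
Qed.

End MF.

Definition M_map (X : topologicalType) (F L : presheaf X)
    (phi : presheaf_hom F L) (x : M F) : M L :=
  existT _ (projT1 x) (phi (projT1 x) (projT2 x)).

(* Main.v *)
Require Import Defs.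
From mathcomp Require Import all_boot all_algebra.
From mathcomp Require Import boolp classical_sets functions cardinality topology.

Import GRing.Theory.
Local Open Scope classical_set_scope.
Local Open Scope ring_scope.

(* An element of M_F is a pair of an open set U and a section over U, and every
   pre-meadow axiom is a ring identity between restrictions to one and the same
   intersection of open sets.  Since 0 * s is the zero section over the domain
   of s, the set 0 * M_F is a copy of Open(X), and the zero of F(set0) = 0
   is the absorbing element a. *)

Lemma sval_inj (T : Type) (P : T -> Prop) : injective (@proj1_sig T P).
Proof. by case=> [x Px] [y Py] /= xy; exact: eq_exist. Qed.

Lemma open_lattice (X : topologicalType) : is_lattice (@open_le X).
Proof.
split=> [U|U V UV VU|U V W|U V|U V]; first exact: subset_refl.
- by apply: sval_inj; apply/seteqP.
- exact: subset_trans.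
- exists (openI_ U V); split; [exact: openI_l|exact: openI_r|].
  by move=> W WU WV x Wx; split; [exact: WU|exact: WV].
- exists (exist _ (sval U `|` sval V) (openU (svalP U) (svalP V))).
  split=> [x Ux|x Vx|W UW VW x]; [by left|by right|].
  by case=> [/UW|/VW].
Qed.

(** The inverse [g] of [f] is adjoint to [f] on both sides ([le_g], [ge_g]), so universal properties
    pass both ways; no meet or join in 0 * M_F has to be built by hand. *)
Lemma order_iso_lattices (A B : Type) (leA : A -> A -> Prop)
    (leB : B -> B -> Prop) (f : A -> B) :
  bijective f -> (forall x y, leA x y <-> leB (f x) (f y)) ->
  is_lattice leB -> isomorphic_lattices leA leB.
Proof.
move=> [g fK gK] le_f [leB_refl leB_anti leB_trans leB_meet leB_join].
have le_g x y : leA x (g y) <-> leB (f x) y by rewrite le_f gK.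
have ge_g x y : leA (g x) y <-> leB x (f y) by rewrite le_f gK.
split; last split; [|by []|exists f; split; first by exists g].
- split=> [x|x y|x y z|x y|x y].
  + exact/le_f.
  + move=> /le_f xy /le_f yx.
    by rewrite -(fK x) -(fK y) (leB_anti _ _ xy yx).
  + by move=> /le_f xy /le_f yz; apply/le_f; exact: leB_trans yz.
  + have [m [mx my max]] := leB_meet (f x) (f y).
    exists (g m); split=> [||w /le_f wx /le_f wy]; [exact/ge_g|exact/ge_g|].
    exact/le_g/max.
  + have [j [xj yj min]] := leB_join (f x) (f y).
    exists (g j); split=> [||w /le_f xw /le_f yw]; [exact/le_g|exact/le_g|].
    exact/ge_g/min.
- move=> x y m [/le_f mx /le_f my max]; split=> // w /ge_g wx /ge_g wy.
  exact/ge_g/max.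
- move=> x y j [/le_f xj /le_f yj min]; split=> // w /le_g xw /le_g yw.
  exact/le_g/min.
Qed.

Section MFacts.
Variables (X : topologicalType) (F : presheaf X).

Lemma res_irrelevance (V U : Open X) (h h' : open_le V U) (s : F U) :
  res F h s = res F h' s.
Proof. by rewrite (Prop_irrelevance h h'). Qed.

(** Needed for open sets such as the intersection of U with [set0], which is not [open0_ X] by
    computation. *)
Lemma sect_set0 (U : Open X) (s : F U) : sval U = set0 -> s = 0.
Proof.
move=> U0; have {}U0 : U = open0_ X by exact: sval_inj.
by case: _ / (esym U0) in s *; exact: sect_empty.
Qed.

(** Restriction along [h] replaces the transport between fibres over equal open sets, so ring
    morphism laws apply to it. *)
Lemma M_ext (s t : M F) : sval (projT1 s) = sval (projT1 t) ->
  (forall h : open_le (projT1 s) (projT1 t), res F h (projT2 t) = projT2 s) ->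
  s = t.
Proof.
case: s t => [U s] [V t] /= UV; have {}UV : U = V by exact: sval_inj.
case: _ / UV in t * => st; have h : open_le U U by [].
by rewrite -(st h) res_id.
Qed.

Lemma res_compE (W V U : Open X) (hWV : open_le W V) (hVU : open_le V U)
    (s : F U) : res F hWV (res F hVU s) = res F (subset_trans hWV hVU) s.
Proof. exact: res_comp. Qed.

Definition M_zero_on (U : Open X) : M F := existT _ U (0 : F U).

Lemma M_mul0 (s : M F) : (0 * s)%pm = M_zero_on (projT1 s).
Proof.
apply: M_ext => [|h]; first exact: setTI.
by rewrite /= rmorph0 rmorph0 mul0r.
Qed.

Lemma M_zero_setP (s : M F) : zero_set s <-> projT2 s = 0.
Proof.
split=> [[x ->]|]; first by rewrite /= rmorph0 mul0r.
by case: s => U s /= ->; exists (M_zero_on U); rewrite M_mul0.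
Qed.

(** Restrictions are pushed inside the operations and fused; after the ring law, both sides differ
    only in their inclusion proofs. *)
Lemma M_pm_axioms : pm_axioms (M F).
Proof.
split.
- move=> x y z; apply: M_ext => /= [|h]; first by rewrite setIA.
  rewrite !rmorphD !res_compE addrA.
  by congr (_ + _ + _); exact: res_irrelevance.
- move=> x y; apply: M_ext => /= [|h]; first by rewrite setIC.
  rewrite !rmorphD !res_compE addrC.
  by congr (_ + _); exact: res_irrelevance.
- move=> x; apply: M_ext => /= [|h]; first by rewrite setIT.
  by rewrite rmorph0 addr0; exact: res_irrelevance.
- move=> x; rewrite M_mul0; apply: M_ext => /= [|h]; first by rewrite setIid.
  rewrite rmorph0 rmorphN; apply/esym/eqP; rewrite subr_eq0; apply/eqP.
  exact: res_irrelevance.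
- move=> x y z; apply: M_ext => /= [|h]; first by rewrite setIA.
  rewrite !rmorphM !res_compE mulrA.
  by congr (_ * _ * _); exact: res_irrelevance.
- move=> x y; apply: M_ext => /= [|h]; first by rewrite setIC.
  rewrite !rmorphM !res_compE mulrC.
  by congr (_ * _); exact: res_irrelevance.
- move=> x; apply: M_ext => /= [|h]; first by rewrite setTI.
  by rewrite rmorph1 mul1r; exact: res_irrelevance.
- move=> x y z; apply: M_ext => /= [|h].
    (* The right-hand side meets the domain of [x] twice. *)
    by rewrite setIACA setIid.
  rewrite !rmorphD !rmorphM !res_compE mulrDr.
  by congr (_ * _ + _ * _); exact: res_irrelevance.
- by case=> U s; rewrite /= /M_opp /= opprK.
- move=> x y; rewrite !M_mul0; apply: M_ext => //= h.
  by rewrite !rmorph0 mul0r rmorph0.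
Qed.

Lemma M_has_a : has_a (M F).
Proof.
pose a := M_zero_on (open0_ X).
have addMa (x : M F) : (x + a)%pm = a.
  apply: M_ext => /= [|h]; first by rewrite setI0.
  by rewrite rmorph0 [RHS]sect_set0 //= setI0.
exists a; split=> [|b [_ _ addMb]].
  split=> //; first exact/M_zero_setP.
  (* If 0 * x = a, the domain of [x] is empty, and the only section there is 0. *)
  suff -> : pm_fiber a = [set a] by exact: card_set1.
  apply/seteqP; split=> [x|x ->]; last exact: M_mul0.
  rewrite /pm_fiber /mkset M_mul0 => /(congr1 (fun y => sval (projT1 y))) /= x0.
  by apply: M_ext => [|h] //; rewrite [LHS]sect_set0 ?[RHS]sect_set0.
(* Two absorbing elements agree: a = b + a = a + b = b. *)
by rewrite -(addMa b) (pm_P2 M_pm_axioms) addMb.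
Qed.

Lemma M_zero_lattice : isomorphic_lattices (@zero_le (M F)) (@open_le X).
Proof.
apply: (@order_iso_lattices _ _ _ _ (fun z => projT1 (sval z))).
- have zs (U : Open X) : zero_set (M_zero_on U) by exact/M_zero_setP.
  exists (fun U => exist _ _ (zs U)) => // -[[U s] z].
  by apply: sval_inj; rewrite /=; move/M_zero_setP: z => /= ->.
- move=> [[U s] zU] [[V t] zV]; rewrite /zero_le /open_le /=.
  move/M_zero_setP: zU => /= ->; move/M_zero_setP: zV => /= ->.
  (* The product of the two zero sections is the zero over their common domain, so z * z' = z
     amounts to an equality of open sets. *)
  split=> [/(congr1 (fun x => sval (projT1 x))) /= <-|UV]; first exact: subIsetr.
  apply: M_ext => /= [|h]; first exact: setIidl.
  by rewrite !rmorph0 mul0r.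
- exact: open_lattice.
Qed.

Lemma M_in_PreMed (Q : pm_struct -> Prop) : Q (M F) -> in_PreMed Q X (M F).
Proof. by split; [|exact: M_has_a|exact: M_zero_lattice]. Qed.

End MFacts.

(** Naturality moves [phi] past the restrictions; the open sets on both sides already agree by
    computation. *)
Lemma M_map_hom (X : topologicalType) (F L : presheaf X)
  (phi : presheaf_hom F L) : is_pm_hom (M_map phi).
Proof.
split=> [x y|x y|].
- by rewrite /M_map /= /M_add /= !app_res rmorphD.
- by rewrite /M_map /= /M_mul /= !app_res rmorphM.
- by rewrite /M_map /= /M_one rmorph1.
Qed.

(** If F(X) is the zero ring then 0 = 1 in M_F. Hence two versions: one excludes these presheaves,
    the other keeps them and lets 0 and 1 coincide in the target. *)
Theorem lemma3p5 (X : topologicalType) :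
  (exists (HM : forall F : PreShNonzero X,
                  in_PreMed is_premeadow X (M (sval F)))
          (Hmap : forall (F L : PreShNonzero X) (phi : mor F L),
                  is_pm_hom (M_map phi)),
     is_functor (C := PreShNonzero X) (D := PreMed X)
       (F0 := fun F => exist _ (M (sval F)) (HM F))
       (fun F L phi => exist _ (M_map phi) (Hmap F L phi)))
  /\
  (exists (HM : forall F : PreSh X, in_PreMed pm_axioms X (M F))
          (Hmap : forall (F L : PreSh X) (phi : mor F L),
                  is_pm_hom (M_map phi)),
     is_functor (C := PreSh X) (D := PreMedWeak X)
       (F0 := fun F => exist _ (M F) (HM F))
       (fun F L phi => exist _ (M_map phi) (Hmap F L phi))).
Proof.
split.
- have HM (F : PreShNonzero X) : in_PreMed is_premeadow X (M (sval F)).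
    by apply: M_in_PreMed; split; [exact/M_zero_neq_one/(proj2_sig F)|exact: M_pm_axioms].
  exists HM, (fun F L phi => M_map_hom X (sval F) (sval L) phi).
  (* Once an element is split into its open set and section, both functor laws hold by
     computation. *)
  by split=> *; apply: PreMed_hom_ext => -[].
- have HM (F : PreSh X) : in_PreMed pm_axioms X (M F).
    by apply: M_in_PreMed; exact: M_pm_axioms.
  exists HM, (fun F L phi => M_map_hom X F L phi).
  by split=> *; apply: PreMed_hom_ext => -[].
Qed.
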